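(* Let $A$ be an idempotent semiring and $\mathcal C$ the set of congruence relations on $A$. Then the map $$Rad:\mathcal C\to\mathcal C,\qquad C\mapsto\sqrt C,$$ is a closure operation on $\mathcal C$ (ordered by inclusion).
   Context: A semiring is a nonempty set $A$ with operations $+,\cdot$ such that $(A,+)$ and $(A,\cdot)$ are commutative monoids (with identities $0$ and $1$), $(a+b)c=ac+bc$ and $0\cdot a=0$; it is idempotent if $a+a=a$ for all $a$. A congruence on $A$ is an equivalence relation $C\subseteq A\times A$ compatible with $+$ and $\cdot$. The twisted product of $x=(x_1,x_2),y=(y_1,y_2)\in A\times A$ is $x\cdot_ty=(x_1y_1+x_2y_2,\;x_1y_2+x_2y_1)$. A congruence $P$ is prime if $P\ne A\times A$ and $x\cdot_ty\in P$ implies $x\in P$ or $y\in P$ for all $x,y\in A\times A$. The radical $\sqrt C$ of a congruence $C$ is the intersection of all prime congruences containing $C$ (equal to $A\times A$ if there are none). A map $cl:\mathcal C\to\mathcal C$ is a closure operation if $C\subseteq C^{cl}$, $(C^{cl})^{cl}=C^{cl}$, and $C_1\subseteq C_2\Rightarrow C_1^{cl}\subseteq C_2^{cl}$ for all $C,C_1,C_2\in\mathcal C$. *)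

(* Defs.v *)
From mathcomp Require Import all_boot all_algebra.
From mathcomp Require Import boolp classical_sets.

Set Implicit Arguments.
Unset Strict Implicit.
Unset Printing Implicit Defensive.

Local Open Scope classical_set_scope.
Local Open Scope ring_scope.

(* The semirings are commutative and 0 = 1 is allowed, hence comPzSemiRingType
   rather than comNzSemiRingType. *)

Definition idempotent_semiring (A : comPzSemiRingType) : Prop :=
  forall a : A, a + a = a.

Record congruence (A : comPzSemiRingType) := Congruence {
  cong_set :> set (A * A);
  cong_refl : forall a, cong_set (a, a);
  cong_sym : forall a b, cong_set (a, b) -> cong_set (b, a);
  cong_trans : forall a b c,
    cong_set (a, b) -> cong_set (b, c) -> cong_set (a, c);
  cong_add : forall a b c d,
    cong_set (a, b) -> cong_set (c, d) -> cong_set (a + c, b + d);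
  cong_mul : forall a b c d,
    cong_set (a, b) -> cong_set (c, d) -> cong_set (a * c, b * d)
}.

Definition twisted_mul (A : comPzSemiRingType) (x y : A * A) : A * A :=
  (x.1 * y.1 + x.2 * y.2, x.1 * y.2 + x.2 * y.1).

Definition prime_congruence (A : comPzSemiRingType) (P : congruence A) : Prop :=
  cong_set P <> setT /\
  forall x y : A * A, cong_set P (twisted_mul x y) -> cong_set P x \/ cong_set P y.

(* If no prime congruence contains C, the empty intersection is setT. *)
Definition radical_set (A : comPzSemiRingType) (C : congruence A) :
    set (A * A) :=
  \bigcap_(P in [set P : congruence A | prime_congruence P /\ C `<=` P]) P.

Definition Rad (A : comPzSemiRingType) (C : congruence A) : congruence A.
Proof.
refine (@Congruence A (radical_set C) _ _ _ _ _).
- by move=> a P _; apply: cong_refl.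
- by move=> a b ab P CP; apply: cong_sym; apply: ab.
- move=> a b c ab bc P CP.
  by apply: (cong_trans (b := b)); [apply: ab | apply: bc].
- by move=> a b c d ab cd P CP; apply: cong_add; [apply: ab | apply: cd].
- by move=> a b c d ab cd P CP; apply: cong_mul; [apply: ab | apply: cd].
Defined.

Definition closure_operation (A : comPzSemiRingType)
    (cl : congruence A -> congruence A) : Prop :=
  [/\ forall C : congruence A, C `<=` cl C,
      forall C : congruence A, cl (cl C) = cl C
    & forall C1 C2 : congruence A, C1 `<=` C2 -> cl C1 `<=` cl C2].

(* Main.v *)
Require Import Defs.
From mathcomp Require Import all_boot all_algebra.
From mathcomp Require Import boolp classical_sets.

Local Open Scope classical_set_scope.

(** A prime congruence contains [C] exactly when it contains [Rad C] ([sub_Rad], [Rad_sub_prime]),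
    so [C] and [Rad C] have the same radical. Enlarging [C] leaves fewer primes above it, hence a
    larger intersection. *)

(** Needed because [cl (cl C) = cl C] equates records, not just sets of pairs; proof irrelevance
    identifies the other fields. *)
Lemma congruence_eq (A : comPzSemiRingType) (C D : congruence A) :
  cong_set C = cong_set D -> C = D.
Proof.
case: C D => [c r1 s1 t1 a1 m1] [d r2 s2 t2 a2 m2] /= cd.
by subst d; congr Congruence; apply: Prop_irrelevance.
Qed.

Lemma sub_Rad (A : comPzSemiRingType) (C : congruence A) : C `<=` Rad C.
Proof. by move=> x Cx P [_ CP]; apply: CP. Qed.

Lemma Rad_sub_prime (A : comPzSemiRingType) (C P : congruence A) :
  prime_congruence P -> C `<=` P -> Rad C `<=` P.
Proof. by move=> primeP CP x; apply. Qed.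

Theorem proposition5p13 (A : comPzSemiRingType) (idemA : idempotent_semiring A) :
  closure_operation (@Rad A).
Proof.
split=> [C | C | C1 C2 C12].
- exact: sub_Rad.
- apply: congruence_eq; apply/seteqP; split; last exact: sub_Rad.
  (* The prime [P] above [C] is also above [Rad C], so it takes part in the intersection defining
     [Rad (Rad C)]. *)
  by move=> x radx P [primeP CP]; apply: radx; split=> //; apply: Rad_sub_prime.
- by move=> x radx P [primeP C2P]; apply: radx; split=> // y /C12 /C2P.
Qed.
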